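(* There exists a sequence $(\mathcal{G}_n)_{n\ge1}$ of regular triangle-free finite simple graphs with $|V(\mathcal{G}_n)|=n$ such that $$\lim_{n\to\infty}q(\mathcal{G}_n)=1.$$
   Context: For a finite graph $\mathcal{G}=(V,E)$, let $\omega(\mathcal{G})$ be the size of a largest clique. A set $T\subseteq V$ is a maximum-clique hitting-set if $T\cap C\ne\emptyset$ for every clique $C$ with $|C|=\omega(\mathcal{G})$. An independent set is a set of vertices no two of which are joined by an edge. Define $$q_s(\mathcal{G})=\min_{T}\ \min_{A\subseteq T}\ \bigl(|T|-|A|\bigr),$$ where $T$ ranges over maximum-clique hitting-sets of $\mathcal{G}$ and $A$ ranges over independent sets of $\mathcal{G}$ contained in $T$, and define $$q(\mathcal{G})=\frac{q_s(\mathcal{G})}{|V(\mathcal{G})|}.$$ *)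

(* Defs.v *)
From mathcomp Require Import all_boot all_algebra.
From mathcomp Require Import reals topology normedtype sequences.

Set Implicit Arguments.
Unset Strict Implicit.
Unset Printing Implicit Defensive.

Record sgraph := SGraph {
  vertex :> finType;
  adj : rel vertex;
  adj_sym : symmetric adj;
  adj_irrefl : irreflexive adj
}.

Definition clique (G : sgraph) (C : {set G}) : bool :=
  [forall x in C, forall y in C, (x != y) ==> adj x y].

Definition independent (G : sgraph) (A : {set G}) : bool :=
  [forall x in A, forall y in A, ~~ adj x y].

Definition omega (G : sgraph) : nat :=
  \max_(C : {set G} | clique C) #|C|.

Definition hitting_set (G : sgraph) (T : {set G}) : bool :=
  [forall C : {set G}, clique C && (#|C| == omega G) ==> (T :&: C != set0)].

(* The neutral elements of the iterated minima do not alter their values on a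
   nonempty graph: #|T| is the value at A = set0, which is independent, and
   #|G| is attained at T = setT, A = set0, where setT is a hitting set.
   The subtraction never truncates, since A \subset T. *)
Definition q_s (G : sgraph) : nat :=
  \big[minn/#|G|]_(T : {set G} | hitting_set T)
    \big[minn/#|T|]_(A : {set G} | (A \subset T) && independent A)
      (#|T| - #|A|).

Definition q (R : realType) (G : sgraph) : R :=
  ((q_s G)%:R / #|G|%:R)%R.

Definition regular (G : sgraph) : Prop :=
  exists d : nat, forall x : G, #|[set y | adj x y]| = d.

Definition triangle_free (G : sgraph) : Prop :=
  forall x y z : G, ~ [/\ adj x y, adj y z & adj x z].

(* Main.v *)
Require Import Defs.
From mathcomp Require Import all_boot all_algebra.
From mathcomp Require Import reals topology normedtype sequences.
From mathcomp Require Import all_order zify ring lra boolp.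
Import numFieldNormedType.Exports.

Set Implicit Arguments.
Unset Strict Implicit.
Unset Printing Implicit Defensive.

Import Order.TTheory GRing.Theory Num.Theory.

(* Once a triangle-free graph has an edge, its maximum-clique hitting sets are the
   vertex covers, so q_s >= n - 2 alpha and it suffices to find, for each k and all
   large n, a regular triangle-free graph on n vertices with k alpha <= n.

   Iterated Mycielski graphs have unbounded fractional chromatic number: there are
   vertex weights of total x such that w(N(J)) >= (x - 1) w(J) for independent J,
   and one more step turns x into x + 1/x.  Given such an H and integers t_i that
   form a B_3-set, the circulant graph on Z/n with connection set
   { t_i - t_j : ij an edge of H } is regular; a triangle in it would give a triangle
   of H, and averaging over the translated copies x - t_i of H bounds its
   independent sets by the weighted ones of H. *)

(** * Weights of vertex sets *)

Section Weights.
Variables (T : finType) (w : T -> rat).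
Local Open Scope ring_scope.

Definition weight (A : {set T}) : rat := \sum_(v in A) w v.

Lemma weightE (A : {set T}) : weight A = \sum_v (v \in A)%:R * w v.
Proof.
by rewrite /weight big_mkcond; apply: eq_bigr => v _; case: (v \in A); rewrite ?mul1r ?mul0r.
Qed.

Lemma weight_set0 : weight set0 = 0.
Proof. exact: big_set0. Qed.

Lemma weightUI (A B : {set T}) :
  weight (A :|: B) + weight (A :&: B) = weight A + weight B.
Proof.
rewrite !weightE -!big_split; apply: eq_bigr => v _ /=.
by rewrite inE in_setI; case: (v \in A); case: (v \in B) => /=; ring.
Qed.

Lemma weightID (A B : {set T}) : weight A = weight (A :&: B) + weight (A :\: B).
Proof.
rewrite !weightE -!big_split; apply: eq_bigr => v _ /=.
by rewrite in_setI in_setD; case: (v \in A); case: (v \in B) => /=; ring.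
Qed.

Hypothesis w_ge0 : forall v, 0 <= w v.

Lemma weight_ge0 (A : {set T}) : 0 <= weight A.
Proof. exact: sumr_ge0. Qed.

Lemma weightS (A B : {set T}) : A \subset B -> weight A <= weight B.
Proof.
move/subsetP=> sAB; rewrite !weightE; apply: ler_sum => v _.
by apply: ler_wpM2r => //; rewrite ler_nat; case: (boolP (v \in A)) => // /sAB ->.
Qed.

Lemma weight_disjU (A B C : {set T}) :
  [disjoint A & B] -> A :|: B \subset C -> weight A + weight B <= weight C.
Proof.
move=> dAB sC; apply: le_trans (weightS sC).
by rewrite -weightUI disjoint_setI0 // weight_set0 addr0.
Qed.

End Weights.

(** * Neighbourhoods and independent sets *)

Definition nbhd (G : sgraph) (J : {set G}) : {set G} :=
  [set y | [exists x in J, adj x y]].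

Lemma independentP (G : sgraph) (J : {set G}) :
  reflect {in J &, forall x y, ~~ adj x y} (independent J).
Proof.
apply: (iffP forall_inP) => [h x y xJ yJ|h x xJ]; first exact: (forall_inP (h x xJ)).
by apply/forall_inP => y yJ; apply: h.
Qed.

Lemma nbhdP (G : sgraph) (J : {set G}) y :
  reflect (exists2 x, x \in J & adj x y) (y \in nbhd J).
Proof. by rewrite inE; apply: exists_inP. Qed.

Lemma big_option (R : Type) (idx : R) (op : Monoid.com_law idx) (I : finType)
    (F : option I -> R) :
  \big[op/idx]_(i : option I) F i = op (F None) (\big[op/idx]_(i : I) F (Some i)).
Proof.
rewrite (bigD1 None) //=; congr (op _ _).
by rewrite (reindex_omap Some id) => [|[]] //=; apply: eq_bigl => i; rewrite eqxx.
Qed.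

(** * The Mycielski construction *)

Section Mycielski.
Variable G : sgraph.

(* [inl v] is an original vertex, [inr (Some v)] its shadow and [inr None] the apex. *)
Definition mycielski_adj (p q : G + option G) : bool :=
  match p, q with
  | inl u, inl v | inl u, inr (Some v) | inr (Some u), inl v => adj u v
  | inr (Some _), inr None | inr None, inr (Some _) => true
  | _, _ => false
  end.

Lemma mycielski_sym : symmetric mycielski_adj.
Proof. by case=> [u|[u|]] [v|[v|]] //=; rewrite adj_sym. Qed.

Lemma mycielski_irrefl : irreflexive mycielski_adj.
Proof. by case=> [u|[u|]] //=; rewrite adj_irrefl. Qed.

Definition mycielski : sgraph := SGraph mycielski_sym mycielski_irrefl.

(** Shadows are pairwise non-adjacent and the apex sees only shadows, so a triangle avoids the apex
    and has at most one shadow; replacing it by its original gives a triangle of [G]. *)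
Lemma mycielski_triangle_free : triangle_free G -> triangle_free mycielski.
Proof.
move=> tf [u|[u|]] [v|[v|]] [z|[z|]] //=; try by case.
all: by move=> ?; apply: (tf u v z).
Qed.

(** [y] will be the inverse of the total [x] of [w], which makes the new total
    [(1 - y) * x + y * x + y = x + y]. *)
Definition mycielski_weight (w : G -> rat) (y : rat) (p : mycielski) : rat :=
  match p : G + option G with
  | inl v => ((1 - y) * w v)%R
  | inr (Some v) => (y * w v)%R
  | inr None => y
  end.

Definition base (I : {set mycielski}) : {set G} :=
  [set v | (inl v : mycielski) \in I].
Definition shadow (I : {set mycielski}) : {set G} :=
  [set v | (inr (Some v) : mycielski) \in I].
Definition apex (I : {set mycielski}) : bool := (inr None : mycielski) \in I.

Lemma weight_mycielski (w : G -> rat) y (I : {set mycielski}) :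
  (weight (mycielski_weight w y) I =
   (1 - y) * weight w (base I) + y * weight w (shadow I) + (apex I)%:R * y)%R.
Proof.
rewrite !weightE big_sumType big_option /= !big_distrr /= -addrA.
congr (_ + _)%R.
  by apply: eq_bigr => v _; rewrite /base inE; ring.
rewrite addrC; congr (_ + _)%R.
by apply: eq_bigr => v _; rewrite /shadow inE; ring.
Qed.

End Mycielski.

(** An independent [J] is disjoint from [nbhd J], so [x * weight w J <= x]: [w] is a fractional
    clique of total [x]. The expansion inequality is the form carried through the induction. *)
Definition expanding (G : sgraph) (w : G -> rat) (x : rat) : Prop :=
  [/\ forall v, (0 <= w v)%R, weight w setT = x &
      forall J : {set G}, independent J ->
        ((x - 1) * weight w J <= weight w (nbhd J))%R].

(** * Expansion under the Mycielski step *)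

Section MycielskiExpansion.
Variables (G : sgraph) (w : G -> rat) (x : rat).
Local Open Scope ring_scope.
Hypotheses (x_ge2 : 2 <= x) (w_exp : expanding w x).

Let w_ge0 v : 0 <= w v. Proof. by case: w_exp. Qed.

(* [K0] collects the vertices of [K] isolated inside [K], so that [J :|: K0] is
   independent, while each vertex of [K :\: K0] lies in [nbhd K]. *)
Lemma weight_nbhdU (J K : {set G}) : independent J -> [disjoint K & nbhd J] ->
  (x - 1) * weight w J + weight w K - weight w (J :&: K)
    <= weight w (nbhd J :|: nbhd K).
Proof.
move=> indJ dKJ; have [_ _ w_nbhd] := w_exp.
pose K0 := [set v in K | [forall u in K, ~~ adj u v]].
have K0K : K0 \subset K by apply/subsetP => v; rewrite inE => /andP[].
have K0P u v : u \in K -> v \in K0 -> adj u v = false.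
  by move=> uK; rewrite inE => /andP[_ /forall_inP/(_ _ uK)/negbTE].
have JKF u v : u \in J -> v \in K -> adj u v = false.
  move=> uJ vK; apply/negP => uv; move/pred0P/(_ v): dKJ => /=.
  by rewrite vK /=; move/nbhdP; apply; exists u.
have indU : independent (J :|: K0).
  apply/independentP => u v /setUP[uJ|uK] /setUP[vJ|vK].
  - by move/independentP: indJ; apply.
  - by rewrite JKF // (subsetP K0K).
  - by rewrite adj_sym JKF // (subsetP K0K).
  - by rewrite K0P // (subsetP K0K).
have JK0 : J :&: K0 = J :&: K.
  apply/setP => v; rewrite !in_setI; case: (boolP (v \in J)) => //= vJ.
  rewrite inE; case: (boolP (v \in K)) => //= vK.
  by apply/forall_inP => u uK; rewrite adj_sym JKF.
have dis : [disjoint nbhd (J :|: K0) & K :\: K0].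
  apply/pred0P => v /=; apply/negP => /andP[/nbhdP[u /setUP[uJ|uK0] uv]].
    by move=> /setDP[vK _]; rewrite JKF in uv.
  by move=> /setDP[vK _]; rewrite adj_sym K0P in uv.
have sub : nbhd (J :|: K0) :|: (K :\: K0) \subset nbhd J :|: nbhd K.
  apply/subsetP => v /setUP[/nbhdP[u /setUP[uJ|uK0] uv]|/setDP[vK]].
  - by apply/setUP; left; apply/nbhdP; exists u.
  - by apply/setUP; right; apply/nbhdP; exists u; rewrite ?(subsetP K0K).
  rewrite inE vK negb_forall_in => /exists_inP[u uK]; rewrite negbK => uv.
  by apply/setUP; right; apply/nbhdP; exists u.
have := weight_disjU w_ge0 dis sub.
have := w_nbhd _ indU; have := weightUI w J K0; rewrite JK0.
have := weightID w K K0; rewrite (setIidPr K0K).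
have mK0 : weight w (J :&: K) <= weight w K0 by rewrite -JK0 weightS ?subsetIr.
(* Expansion of [J :|: K0] plus the weight of [K :\: K0] exceeds the desired bound by exactly this
   product. *)
have : 0 <= (x - 2) * (weight w K0 - weight w (J :&: K)).
  by rewrite mulr_ge0 ?subr_ge0.
move: {mK0}(weight w J) (weight w K) (weight w (_ :&: _)) (weight w K0) => j k m k0.
move: (weight w (_ :\: _)) (weight w (_ :|: _)) (weight w (nbhd (_ :|: _))) => k1 u nu.
move: (weight w _) => W h1 -> h2; have -> : u = j + k0 - m by lra.
by move=> h3 h4; nra.
Qed.

(** The choice [y = 1/x] gives [y * (x - 1) = 1 - y]. The neighbourhood of [I] has base
    [nbhd J :|: nbhd K], shadow part [nbhd J] (everything if the apex is in [I]), and contains the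
    apex exactly when [K] is nonempty. The cases are: apex in [I], which forces [K] empty; apex
    outside with [K] empty; apex outside with [K] nonempty. *)
Lemma mycielski_expanding :
  @expanding (mycielski G) (mycielski_weight w x^-1) (x + x^-1).
Proof.
have [_ wT w_nbhd] := w_exp; set y := x^-1.
have x0 : 0 < x by rewrite (lt_le_trans _ x_ge2).
have xy : x * y = 1 by rewrite divff // gt_eqF.
have y0 : 0 <= y by rewrite invr_ge0 ltW.
have y1 : y <= 1 by rewrite invf_le1 // (le_trans _ x_ge2).
split.
- by case=> [v|[v|]] //=; rewrite mulr_ge0 ?subr_ge0.
- rewrite weight_mycielski /apex in_setT.
  have -> : base [set: mycielski G] = setT by apply/setP => v; rewrite !inE.
  have -> : shadow [set: mycielski G] = setT by apply/setP => v; rewrite !inE.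
  by rewrite wT /=; ring.
move=> I /independentP indI; rewrite !weight_mycielski.
set J := base I; set K := shadow I.
have indJ : independent J.
  by apply/independentP => u v; rewrite !inE => uI vI; apply: (indI (inl u) (inl v)).
have nbJ := w_nbhd _ indJ.
have -> : base (nbhd I) = nbhd J :|: nbhd K.
  apply/setP => v; rewrite inE; apply/nbhdP/setUP.
    case=> -[u|[u|]] //= uI uv; [left|right];
    by apply/nbhdP; exists u; rewrite ?inE.
  by case=> /nbhdP[u]; rewrite inE => uI uv; [exists (inl u)|exists (inr (Some u))].
have nbshadow : if apex I then shadow (nbhd I) = setT else shadow (nbhd I) = nbhd J.
  case: ifP => aI; apply/setP => v; rewrite inE ?in_setT.
    by apply/nbhdP; exists (inr None).
  apply/nbhdP/nbhdP => [[[u|[u|]]] //= uI uv|[u]]; last first.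
  - by rewrite inE; exists (inl u).
  - by rewrite /apex uI in aI.
  - by exists u; rewrite ?inE.
have nbapex : apex (nbhd I) = (K != set0).
  apply/nbhdP/set0Pn => [[[u|[u|]]] //= uI _|[u]].
    by exists u; rewrite inE.
  by rewrite inE; exists (inr (Some u)).
have wJ0 := weight_ge0 w_ge0 J.
have y1a : y * (x - 1) = 1 - y by rewrite mulrBr mulr1 mulrC xy.
rewrite nbapex; case: (boolP (apex I)) nbshadow => aI ->.
  have -> : K = set0.
    apply/setP => v; rewrite !inE; apply/negP => vI.
    by have := indI _ _ vI aI.
  rewrite eqxx /= wT !weight_set0 /= !mulr0 !mul0r !addr0 !mul1r.
  have sJ : weight w (nbhd J) <= weight w (nbhd J :|: nbhd set0).
    by rewrite weightS ?subsetUl.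
  have : weight w J <= 1.
    have : weight w J + weight w (nbhd J) <= x.
      rewrite -wT; apply: weight_disjU => //; apply/pred0P => v /=.
      apply/negP => /andP[vJ /nbhdP[u uJ]]; apply/negP.
      by move/independentP: indJ; apply.
    by move: nbJ x_ge2; clear; move=> ? ? ?; nra.
  have : (1 - y) * ((x - 1) * weight w J) <= (1 - y) * weight w (nbhd J :|: nbhd set0).
    by rewrite ler_wpM2l ?subr_ge0 ?(le_trans nbJ).
  move=> wa w1.
  have : 0 <= y * (1 - y) * (1 - weight w J) by rewrite !mulr_ge0 ?subr_ge0.
  by move: wa; move: (weight w J) (weight w _) => j W h1 h2; nra.
have dKJ : [disjoint K & nbhd J].
  apply/pred0P => v /=; apply/negP => /andP[]; rewrite inE => vI /nbhdP[u].
  by rewrite inE => uI uv; have /negP := indI _ _ uI vI; apply.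
have [-> | K0] := eqVneq K set0.
  rewrite /= weight_set0 !mul0r !mulr0 !addr0.
  have : (1 - y) * ((x - 1) * weight w J) <= (1 - y) * weight w (nbhd J :|: nbhd set0).
    by rewrite ler_wpM2l ?subr_ge0 ?(le_trans nbJ) ?weightS ?subsetUl.
  have : y * ((x - 1) * weight w J) <= y * weight w (nbhd J) by rewrite ler_wpM2l.
  rewrite mulrA y1a; have : 0 <= (1 - y) * (1 - y) * weight w J.
    by rewrite !mulr_ge0 ?subr_ge0.
  by move: (weight w J) (weight w _) (weight w _) => j V W h1 h2 h3; lra.
have wKJ := weight_nbhdU indJ dKJ.
have JKx : weight w K + weight w (nbhd J) <= x.
  by rewrite -wT; apply: weight_disjU.
have JKJ : weight w (J :&: K) <= weight w J by rewrite weightS ?subsetIl.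
rewrite /= mul1r mul0r addr0.
move: wJ0 nbJ wKJ JKx JKJ.
move: (weight w J) (weight w K) (weight w (nbhd J)) (weight w (J :&: K)).
move: (weight w (nbhd J :|: nbhd K)) => W j k V m.
move=> j0 jV jkW kVx mj.
have a0 : 0 <= 1 - y by rewrite subr_ge0.
have h1 := ler_wpM2l a0 jkW; have h2 := ler_wpM2l a0 mj.
have h3 := ler_wpM2l y0 jV; rewrite mulrA y1a in h3.
(* The left side equals [(1 - y) * j + y * k], the weight of [I], which is thus at most 1. So the
   apex, of weight [y], pays for the extra [y] in the expansion factor, while the shadows of
   [nbhd J] pay for the loss [m]. *)
have : y * (k + (x - 1) * j) <= y * x.
  by rewrite ler_wpM2l // (le_trans _ kVx) // lerD2l.
rewrite mulrDr (mulrA y (x - 1)) y1a [y * x]mulrC xy => /(ler_wpM2l y0) h4.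
have h5 : y * (x - 1) * k = (1 - y) * k by rewrite y1a.
by lra.
Qed.

End MycielskiExpansion.

(** * Iteration from the single edge *)

Lemma bool_adj_irrefl : irreflexive (fun a b : bool => a != b).
Proof. by move=> a; rewrite eqxx. Qed.

Definition K2 : sgraph :=
  @SGraph bool (fun a b => a != b) (fun a b => congr1 negb (eq_sym a b)) bool_adj_irrefl.

Lemma K2_expanding : @expanding K2 (fun=> 1%R) 2%R.
Proof.
split=> [||J /independentP indJ] //.
  by rewrite /weight sumr_const cardsT card_bool.
have -> : (2 - 1 = 1 :> rat)%R by [].
rewrite mul1r /weight !sumr_const ler_nat -(card_imset _ (can_inj negbK)).
apply/subset_leq_card/subsetP => _ /imsetP[b bJ ->].
by apply/nbhdP; exists b => //=; case: b bJ.
Qed.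

(** The square of [x + 1/x] exceeds [x ^ 2 + 2], so each Mycielski step raises [x ^ 2] by more than
    1. *)
Lemma triangle_free_expanding (m : nat) :
  exists (G : sgraph) (w : G -> rat) (x : rat),
    [/\ triangle_free G, expanding w x, (2 <= x)%R & (m%:R <= x ^+ 2)%R].
Proof.
elim: m => [|m [G [w [x [tfG w_exp x2 mx]]]]].
  exists K2, (fun=> 1%R), 2%R; split=> //; last exact: K2_expanding.
  by do 3!case=> [] []//.
have x0 : (0 < x)%R by lra.
have y0 : (0 < x^-1)%R by rewrite invr_gt0.
have xy : (x * x^-1 = 1)%R by rewrite divff // gt_eqF.
exists (mycielski G), (mycielski_weight w x^-1), (x + x^-1)%R; split.
- exact: mycielski_triangle_free.
- exact: mycielski_expanding.
- lra.
- by rewrite -natr1; nra.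
Qed.

Lemma triangle_free_small_independent (k : nat) :
  exists (G : sgraph) (w : G -> rat),
    [/\ triangle_free G, (0 < weight w setT)%R &
        forall J : {set G}, independent J -> (k%:R * weight w J <= weight w setT)%R].
Proof.
have [G [w [x [tfG [w0 wT w_nbhd] x2 kx]]]] := triangle_free_expanding (k * k).
have k_le : (k%:R <= x)%R.
  have x0 : (0 <= x)%R by lra.
  by rewrite -(@ler_pXn2r _ 2) ?nnegrE // -natrX -mulnn.
exists G, w; split=> // [|J indJ]; first by rewrite wT; lra.
have dis : (weight w J + weight w (nbhd J) <= weight w setT)%R.
  apply: weight_disjU => //; apply/pred0P => v /=; apply/negP => /andP[vJ /nbhdP[u uJ]].
  by apply/negP; move/independentP: indJ; apply.
have := w_nbhd _ indJ; have := weight_ge0 w0 J; move: dis; nra.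
Qed.

(** * Powers of four form a B_3-set *)

Lemma base4_inj m (c d : nat -> nat) :
  (forall i, c i < 4) -> (forall i, d i < 4) ->
  \sum_(i < m) c i * 4 ^ i = \sum_(i < m) d i * 4 ^ i ->
  forall i, i < m -> c i = d i.
Proof.
elim: m c d => // m IH c d c4 d4; rewrite !big_ord_recl !muln1.
have shift (e : nat -> nat) :
    \sum_(i < m) e (lift ord0 i) * 4 ^ lift ord0 i
    = 4 * \sum_(i < m) e i.+1 * 4 ^ i.
  by rewrite big_distrr; apply: eq_bigr => i _ /=; rewrite /bump leq0n expnS mulnCA.
rewrite !shift /= => E; have := c4 0; have := d4 0 => d04 c04.
have E0 : c 0 = d 0 by lia.
case=> [|i] // im; apply: (IH (c \o succn) (d \o succn)) => //=; lia.
Qed.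

(** With at most three terms no carry occurs: the multiplicities of the exponents are the base-4
    digits of the sum. *)
Lemma perm_sum_expn4 (s t : seq nat) : size s < 4 -> size t < 4 ->
  \sum_(i <- s) 4 ^ i = \sum_(i <- t) 4 ^ i -> perm_eq s t.
Proof.
move=> s4 t4 E; pose m := (\max_(i <- s ++ t) i).+1.
have digits (r : seq nat) : {subset r <= s ++ t} ->
    \sum_(i <- r) 4 ^ i = \sum_(i < m) count_mem (i : nat) r * 4 ^ i.
  elim: r => [|x r IH] sr; first by rewrite big_nil big1.
  rewrite big_cons IH => [|y yr]; last by rewrite sr // inE yr orbT.
  have xm : x < m by rewrite ltnS; apply: (@leq_bigmax_seq _ _ xpredT id); rewrite // sr ?mem_head.
  have -> : 4 ^ x = \sum_(i < m | i == Ordinal xm) 4 ^ i by rewrite big_pred1_eq.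
  rewrite big_mkcond -big_split; apply: eq_bigr => i _ /=.
  by rewrite -val_eqE eq_sym /=; case: eqP => //=; rewrite mulnDl mul1n.
have count4 (r : seq nat) i : size r < 4 -> count_mem i r < 4.
  exact/leq_ltn_trans/count_size.
apply/allP => x xst; apply/eqP.
apply: (@base4_inj m (fun i => count_mem i s) (fun i => count_mem i t)) => [i|i||].
- exact: count4.
- exact: count4.
- by rewrite -!digits // => y yr; rewrite mem_cat yr ?orbT.
- by rewrite ltnS; apply: (@leq_bigmax_seq _ _ xpredT id).
Qed.

(** * Cayley graphs from labelled graphs *)

Section Cayley.
Variables (H : sgraph) (Z : finZmodType) (t : H -> Z).
Local Open Scope ring_scope.

(** The connection set consists of the differences [t i - t j] along edges; the equation uses sums
    so that edges can be added up. *)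
Definition cayley_adj (x y : Z) : bool :=
  [exists i, exists j, adj i j && (x + t i == y + t j)].

Lemma cayley_adjP x y :
  reflect (exists i j, adj i j /\ x + t i = y + t j) (cayley_adj x y).
Proof.
apply: (iffP existsP) => [[i /existsP[j /andP[ij /eqP e]]]|[i [j [ij e]]]].
  by exists i, j.
by exists i; apply/existsP; exists j; rewrite ij e eqxx.
Qed.

Lemma cayley_sym : symmetric cayley_adj.
Proof.
by move=> x y; apply/cayley_adjP/cayley_adjP => -[i [j [ij e]]];
  exists j, i; rewrite adj_sym.
Qed.

Hypothesis t_inj : injective t.

Lemma cayley_irrefl : irreflexive cayley_adj.
Proof.
move=> x; apply/cayley_adjP => -[i [j [ij /addrI/t_inj eij]]].
by rewrite eij adj_irrefl in ij.
Qed.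

Definition cayley : sgraph := SGraph cayley_sym cayley_irrefl.

Lemma cayley_regular : regular cayley.
Proof.
exists #|[set y : cayley | cayley_adj 0 y]| => x.
rewrite -[RHS](card_imset _ (@addrI Z x)); apply: eq_card => y; rewrite inE.
have e (z : Z) : cayley_adj x (x + z) = cayley_adj 0 z.
  rewrite /cayley_adj; apply: eq_existsb => i; apply: eq_existsb => j.
  by rewrite add0r -addrA (inj_eq (@addrI Z x)).
apply/idP/imsetP => [xy|[z + ->]]; last by rewrite inE /= e.
by exists (y - x); rewrite ?inE -?e addrC subrK.
Qed.

(** Adding the three edge equations cancels [x], [y], [z], so [i, k, m] is a rearrangement of
    [j, l, p]. Since [ij], [kl], [mp] are edges, no index meets its own partner; the rearrangement
    is one of the two cyclic ones, and each closes the edges into a triangle of [H]. *)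
Lemma cayley_triangle_free :
  (forall a b c a' b' c', t a + t b + t c = t a' + t b' + t c' ->
     perm_eq [:: a; b; c] [:: a'; b'; c']) ->
  triangle_free H -> triangle_free cayley.
Proof.
move=> t_B3 tfH x y z [/cayley_adjP[i [j [ij e1]]] /cayley_adjP[k [l [kl e2]]]].
rewrite adj_sym => /cayley_adjP[m [p [mp e3]]].
have /t_B3 perm : t i + t k + t m = t j + t l + t p.
  have e : (x + t i) + (y + t k) + (z + t m) = (y + t j) + (z + t l) + (x + t p).
    by rewrite e1 e2 e3.
  move: e; rewrite (addrACA x) (addrACA (x + y)) (addrACA y) (addrACA (y + z)).
  by rewrite [y + z + x]addrC [x + (y + z)]addrA => /addrI.
have : i \in [:: j; l; p] by rewrite -(perm_mem perm) mem_head.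
rewrite !inE => /or3P[] /eqP ei; subst i; first by rewrite adj_irrefl in ij.
- move: perm; rewrite perm_sym (perm_catCA [:: j] [:: l] [:: p]) /= perm_cons perm_sym.
  move=> perm; move: (perm); have : k \in [:: j; p] by rewrite -(perm_mem perm) mem_head.
  rewrite !inE => /orP[] /eqP ek; subst k.
    by rewrite perm_cons => /perm_mem/(_ m); rewrite !inE eqxx => /esym/eqP em;
      rewrite em adj_irrefl in mp.
  rewrite perm_sym (perm_catC [:: j] [:: p]) perm_cons => /perm_mem/(_ j).
  rewrite !inE eqxx => /esym/eqP em; subst m.
  by apply: (tfH l j p); rewrite (adj_sym l p).
- move: perm; rewrite perm_sym (perm_catCA [:: j; l] [:: p] [::]) /= perm_cons perm_sym.
  move=> perm; move: (perm); have : k \in [:: j; l] by rewrite -(perm_mem perm) mem_head.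
  rewrite !inE => /orP[] /eqP ek; subst k; last by rewrite adj_irrefl in kl.
  rewrite perm_cons => /perm_mem/(_ m); rewrite !inE eqxx => /esym/eqP em; subst m.
  by apply: (tfH p j l); rewrite (adj_sym p l).
Qed.

Lemma cayley_independent (w : H -> rat) (k : nat) (A : {set cayley}) :
  0 < weight w setT ->
  (forall J : {set H}, independent J -> k%:R * weight w J <= weight w setT) ->
  independent A -> (k * #|A| <= #|Z|)%N.
Proof.
move=> wT w_ind /independentP indA.
pose S (x : Z) := [set i : H | (x - t i : cayley) \in A].
have indS x : independent (S x).
  apply/independentP => i j; rewrite !inE => xi xj; apply: contra (indA _ _ xi xj).
  by move=> ij; apply/cayley_adjP; exists i, j; rewrite !subrK.
(* Double counting: for fixed [i], translation by [t i] is a bijection, so [i] lies in [S x] for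
   exactly [#|A|] values of [x]. *)
have count : \sum_(x : Z) weight w (S x) = #|A|%:R * weight w setT.
  under eq_bigr do rewrite weightE.
  rewrite exchange_big mulr_sumr; apply: eq_big => [i|i _]; first by rewrite in_setT.
  rewrite -mulr_suml; congr (_ * _).
  rewrite (reindex_inj (addIr (t i))) -sum1_card natr_sum [RHS]big_mkcond.
  by apply: eq_bigr => x _; rewrite inE addrK; case: (x \in A).
rewrite -(ler_nat rat) -(ler_pM2r wT) natrM -mulrA -count mulr_sumr.
apply: le_trans (ler_sum _ (fun x _ => w_ind _ (indS x))) _.
by rewrite sumr_const mulr_natl.
Qed.

End Cayley.

(** * Regular triangle-free graphs of every large order *)

Lemma regular_triangle_free_small_independent (k : nat) :
  exists N : nat, forall n, N <= n ->
    exists G : sgraph, [/\ #|G| = n, regular G, triangle_free G &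
      forall A : {set G}, independent A -> k * #|A| <= n].
Proof.
have [H [w [tfH wT w_ind]]] := triangle_free_small_independent k.
(* This size keeps sums of three labels below the modulus, so the B_3 property of integers passes to
   the cyclic group. *)
exists (3 * 4 ^ #|H|).+1 => -[|n] //; rewrite ltnS => n_big.
pose t (i : H) : 'I_n.+1 := inord (4 ^ enum_rank i).
have le4 (i : H) : 4 ^ enum_rank i <= 4 ^ #|H| by rewrite leq_exp2l // ltnW.
have tE i : t i = 4 ^ enum_rank i :> nat.
  rewrite inordK // ltnS (leq_trans (le4 i)) // (leq_trans _ n_big) //.
  by rewrite leq_pmull.
have t_sum a b c : (t a + t b + t c)%R =
    4 ^ enum_rank a + 4 ^ enum_rank b + 4 ^ enum_rank c :> nat.
  have := (le4 a, le4 b, le4 c); rewrite /= !tE; move: n_big {tE le4}.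
  move: (4 ^ #|H|) (4 ^ enum_rank a) (4 ^ enum_rank b) (4 ^ enum_rank c) => M a4 b4 c4 Mn [[aM bM] cM].
  by rewrite [(a4 + b4) %% _]modn_small ?modn_small; lia.
have t_B3 a b c a' b' c' : (t a + t b + t c = t a' + t b' + t c')%R ->
    perm_eq [:: a; b; c] [:: a'; b'; c'].
  move/(congr1 (@nat_of_ord _)); rewrite !t_sum => e.
  have inj : injective (fun i : H => nat_of_ord (enum_rank i)).
    by move=> i j /val_inj/enum_rank_inj.
  apply: (perm_map_inj inj); apply: perm_sum_expn4 => //=.
  by rewrite !big_cons !big_nil !addn0 !addnA.
have t_inj : injective t.
  move=> i j e; have /perm_mem/(_ i) : perm_eq [:: i; i; i] [:: j; j; j].
    by apply: t_B3; rewrite e.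
  by rewrite !inE eqxx !orbb => /esym/eqP.
exists (cayley t_inj); split=> [|||A indA].
- by rewrite card_ord.
- exact: cayley_regular.
- exact: cayley_triangle_free.
- by have := cayley_independent wT w_ind indA; rewrite card_ord.
Qed.

(** * Hitting sets and bounds on [q_s] *)

Section HittingSets.
Variable G : sgraph.

Lemma omega_triangle_free (x y : G) : triangle_free G -> adj x y -> omega G = 2.
Proof.
move=> tf xy; apply/eqP; rewrite eqn_leq; apply/andP; split.
  apply/bigmax_leqP => C /forall_inP clC; rewrite leqNgt; apply/negP.
  move=> /card_gt2P[a [b [c [[aC bC cC] [ab bc ca]]]]].
  have cl u v : u \in C -> v \in C -> u != v -> adj u v.
    by move=> uC vC; move/forall_inP: (clC u uC) => /(_ v vC) /implyP.
  by apply: (tf a b c); split; apply: cl; rewrite // eq_sym.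
have nxy : x != y by apply: contraTneq xy => ->; rewrite adj_irrefl.
rewrite (_ : 2 = #|[set x; y]|); last by rewrite cards2 nxy.
apply: (@leq_bigmax_cond _ _ (fun C : {set G} => #|C|)).
apply/forall_inP => u /set2P[] ->; apply/forall_inP => v /set2P[] ->;
  by rewrite ?eqxx ?xy 1?adj_sym ?xy ?implybT.
Qed.

(** Maximum cliques are edges here, and an edge inside the complement would be missed by [T]. *)
Lemma hitting_set_setC_independent (x y : G) (T : {set G}) :
  triangle_free G -> adj x y -> hitting_set T -> independent (~: T).
Proof.
move=> tf xy /forallP hitT; apply/independentP => u v; rewrite !in_setC => uT vT.
apply/negP => uv; have := hitT [set u; v].
have nuv : u != v by apply: contraTneq uv => ->; rewrite adj_irrefl.
rewrite cards2 nuv (omega_triangle_free tf xy) eqxx andbT.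
have -> : clique [set u; v].
  apply/forall_inP => a /set2P[] ->; apply/forall_inP => b /set2P[] ->;
    by rewrite ?eqxx ?uv 1?adj_sym ?uv ?implybT.
move/set0Pn => [z /setIP[zT /set2P[]] ez]; subst z; first by rewrite zT in uT.
by rewrite zT in vT.
Qed.

Lemma q_s_le : q_s G <= #|G|.
Proof.
rewrite /q_s; elim/big_rec: _ => // T m _ mG; exact: leq_trans (geq_minr _ _) mG.
Qed.

(** Both [~: T] and [A] have at most [#|G| / k] elements, and each costs one [#|G|]. The neutral
    elements of both minima satisfy the same bound. *)
Lemma q_s_ge (x y : G) (k : nat) : triangle_free G -> adj x y ->
  (forall A : {set G}, independent A -> k * #|A| <= #|G|) ->
  k * #|G| <= k * q_s G + 2 * #|G|.
Proof.
move=> tf xy small.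
have hit (T : {set G}) : hitting_set T -> k * #|G| <= k * #|T| + #|G|.
  move=> hT; rewrite -(cardsC T) mulnDr leq_add2l cardsC.
  exact/small/(hitting_set_setC_independent tf xy).
rewrite /q_s; elim/big_ind: _ => [|a b ha hb|T hT].
- exact: leq_addr.
- by rewrite /minn; case: ifP.
have hitT := hit T hT.
elim/big_ind: _ => [|a b ha hb|A /andP[sAT indA]].
- by lia.
- by rewrite /minn; case: ifP.
have := small A indA; have := subset_leq_card sAT.
by rewrite mulnBr; lia.
Qed.

End HittingSets.

(** * Choosing one graph per order *)

Lemma edgeless_irrefl n : irreflexive (fun _ _ : 'I_n => false).
Proof. by []. Qed.

Definition edgeless n : sgraph :=
  @SGraph 'I_n (fun _ _ => false) (fun _ _ => erefl) (@edgeless_irrefl n).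

Definition admissible (n : nat) (G : sgraph) : Prop :=
  [/\ #|G| = n, regular G & triangle_free G].

Lemma admissible_edgeless n : admissible n (edgeless n).
Proof.
split; first by rewrite card_ord.
  by exists 0 => x; apply: eq_card0 => y; rewrite inE.
by move=> x y z [].
Qed.

(** The sequence must serve all [k] at once, while the construction depends on [k]; a maximizer of
    [q_s] dominates every such graph. Edgeless graphs make the choice possible for every [n]. *)
Lemma exists_admissible_maximizer n :
  exists G, admissible n G /\ forall G', admissible n G' -> q_s G' <= q_s G.
Proof.
pose P m := `[< exists2 G, admissible n G & q_s G = m >].
have exP : exists m, P m.
  exists (q_s (edgeless n)); apply/asboolP.
  by exists (edgeless n); first exact: admissible_edgeless.
have ubP m : P m -> m <= n.
  by move/asboolP => [G [<- _ _] <-]; exact: q_s_le.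
case: (ex_maxnP exP ubP) => m /asboolP[G aG qG] maxm.
exists G; split=> // G' aG'; rewrite qG; apply: maxm.
by apply/asboolP; exists G'.
Qed.

(** * The limit *)

Local Open Scope classical_set_scope.

(* The term G 0 is unconstrained and irrelevant to the limit. *)
Theorem mainTheorem3 (R : realType) :
  exists G : nat -> sgraph,
    (forall n : nat, 0 < n ->
       [/\ #|G n| = n, regular (G n) & triangle_free (G n)]) /\
    q R (G n) @[n --> \oo] --> (1%R : R).
Proof.
have [G admG] := boolp.choice exists_admissible_maximizer.
exists G; split=> [n _|]; first exact: (admG n).1.
apply/cvgrPdist_le => /= e e0.
(* The bound gives [2 / e <= k]; the added 2 ensures [k >= 2], which excludes an edgeless [G'],
   whose full vertex set would give [k * n <= n] with [n > 0]. *)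
pose k := (Num.bound (2 / e)%R).+2.
have [N smallN] := regular_triangle_free_small_independent k.
exists (maxn N 1) => // n; rewrite /= geq_max => /andP[Nn n0].
have [[cardG _ _] maxG] := admG n.
have [G' [cardG' regG' tfG' smallG']] := smallN n Nn.
have [x [y xy]] : exists x y : G', adj x y.
  apply: contrapT => noedge; have := smallG' setT; rewrite cardsT cardG'.
  have -> : independent [set: G'].
    by apply/independentP => x y _ _; apply/negP => xy; apply: noedge; exists x, y.
  by move=> /(_ isT); rewrite /k; lia.
have := q_s_ge (k := k) tfG' xy; rewrite cardG' => /(_ smallG') lb'.
have lb : k * n <= k * q_s (G n) + 2 * n.
  apply: leq_trans lb' _; rewrite leq_add2r leq_mul2l maxG ?orbT //.
have ub := q_s_le (G n); rewrite cardG in ub.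
rewrite /q cardG.
have n0R : (0 < n%:R :> R)%R by rewrite ltr0n.
have ke : (2 / e <= k%:R :> R)%R.
  apply: le_trans (ltW (archi_boundP _)) _; first by rewrite divr_ge0 // ltW.
  by rewrite ler_nat /k; lia.
have k0R : (0 < k%:R :> R)%R by rewrite ltr0n.
rewrite ger0_norm ?subr_ge0 ?ler_pdivrMr ?mul1r ?ler_nat //.
rewrite lerBlDr -lerBlDl ler_pdivlMr //.
move: lb; rewrite -(ler_nat R) natrD !natrM => lb.
(* After scaling by [k], the deficit of [q_s (G n)] from [n] is at most [2 * n], and
   [2 <= e * k]. *)
rewrite -(ler_pM2l k0R).
rewrite ler_pdivrMr // in ke.
nra.
Qed.
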